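(* Let $(\Omega,\mathcal F)$ be a measurable space and let $\mathcal P,\mathcal Q\subset\mathcal M_1$ be arbitrary nonempty sets of (countably additive) probability measures on it. Then for every $\varepsilon\ge 0$, $$\exists\,\phi\in\Phi:\ \inf_{\nu\in\mathcal Q}\mathbb E_\nu[\phi]>\sup_{\mu\in\mathcal P}\mathbb E_\mu[\phi]+\varepsilon\quad\Longleftrightarrow\quad \mathrm d_{\mathrm{TV}}\big(\overline{\mathrm{co}}^*(\mathcal P),\overline{\mathrm{co}}^*(\mathcal Q)\big)>\varepsilon.$$ In fact, $$R(\mathcal P,\mathcal Q)=1-\mathrm d_{\mathrm{TV}}\big(\overline{\mathrm{co}}^*(\mathcal P),\overline{\mathrm{co}}^*(\mathcal Q)\big),$$ and the infimum defining $\mathrm d_{\mathrm{TV}}(\overline{\mathrm{co}}^*(\mathcal P),\overline{\mathrm{co}}^*(\mathcal Q))$ is achieved by some $\mu\in\overline{\mathrm{co}}^*(\mathcal P)$ and $\nu\in\overline{\mathrm{co}}^*(\mathcal Q)$.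
   Context: $\mathcal M_1$ is the set of all countably additive probability measures on $(\Omega,\mathcal F)$. A test is an $\mathcal F$-measurable function $\phi:\Omega\to[0,1]$; $\Phi$ is the set of all tests. The risk of a test is $R(\phi,\mathcal P,\mathcal Q)=\sup_{\mu\in\mathcal P}\mathbb E_\mu[\phi]+\sup_{\nu\in\mathcal Q}\mathbb E_\nu[1-\phi]$ and the minimax risk is $R(\mathcal P,\mathcal Q)=\inf_{\phi\in\Phi}R(\phi,\mathcal P,\mathcal Q)$. $\mathcal L$ is the Banach space of bounded measurable real functions on $\Omega$ with the supremum norm. $\mathsf{ba}$ is the space of bounded finitely additive real-valued set functions on $\mathcal F$, with norm $\|\mu\|_{\mathrm{TV}}=\sup_\pi\sum_{A\in\pi}|\mu(A)|$ (supremum over finite measurable partitions $\pi$ of $\Omega$); it is the dual of $\mathcal L$ via $\mathbb E_\mu[f]=\int f\,d\mu$ (integral of simple functions extended by uniform limits). $\mathsf{ba}_1$ is the set of nonnegative elements of $\mathsf{ba}$ with $\mu(\Omega)=1$; $\mathcal M_1\subset\mathsf{ba}_1$. The weak-$*$ topology on $\mathsf{ba}$ is the weakest topology making $\mu\mapsto\mathbb E_\mu[f]$ continuous for all $f\in\mathcal L$. $\mathrm{co}(\mathcal P)$ is the convex hull and $\overline{\mathrm{co}}^*(\mathcal P)$ is the weak-$*$ closure in $\mathsf{ba}$ of $\mathrm{co}(\mathcal P)$. For $\mu,\nu\in\mathsf{ba}_1$, $\mathrm d_{\mathrm{TV}}(\mu,\nu)=\tfrac12\|\mu-\nu\|_{\mathrm{TV}}=\sup_{\phi\in\Phi}(\mathbb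 E_\mu[\phi]-\mathbb E_\nu[\phi])$; for nonempty $S,T\subset\mathsf{ba}_1$, $\mathrm d_{\mathrm{TV}}(S,T)=\inf_{\mu\in S,\nu\in T}\mathrm d_{\mathrm{TV}}(\mu,\nu)$. *)

(* Defs.v *)
From HB Require Import structures.
From mathcomp Require Import all_boot all_order all_algebra.
From mathcomp Require Import all_classical all_reals all_analysis.

Set Implicit Arguments.
Unset Strict Implicit.
Unset Printing Implicit Defensive.

Import Order.TTheory GRing.Theory Num.Theory.
Import numFieldNormedType.Exports HBSimple.

Local Open Scope classical_set_scope.
Local Open Scope ring_scope.

Section ba.
Context (d : measure_display) (T : measurableType d) (R : realType).

(* Set functions are total on [set T], so they are normalized to 0 outside the
   sigma-algebra: equality in [ba] is equality on the measurable sets. *)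
Definition is_ba : {pred (set T -> R^o)} := mem
  [set mu : set T -> R^o |
    [/\ measure_function.additive2 (fun A => (mu A)%:E),
        exists M : R, forall A, measurable A -> `|mu A| <= M
      & forall A, ~ measurable A -> mu A = 0]].

Lemma is_ba_submod_closed : submod_closed is_ba.
Proof.
split.
  rewrite inE; split=> //; first by move=> A B _ _ _; rewrite /= -EFinD addr0.
  by exists 0 => A _; rewrite normr0.
move=> c mu nu; rewrite !inE => -[muD [M muM] mu0] [nuD [N nuN] nu0]; split.
- move=> A B mA mB AB.
  have [muAB] := muD A B mA mB AB; have [nuAB] := nuD A B mA mB AB.
  by rewrite -EFinD; congr EFin; rewrite !fctE muAB nuAB scalerDr addrACA.
- exists (`|c| * M + N) => A mA.
  rewrite !fctE (le_trans (ler_normD _ _))// lerD ?nuN//.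
  by rewrite normrM ler_wpM2l ?muM.
- by move=> A mA; rewrite !fctE mu0// nu0// scaler0 addr0.
Qed.

HB.instance Definition _ := GRing.isSubmodClosed.Build _ _ is_ba
  is_ba_submod_closed.

Record ba := Ba { ba_val :> set T -> R^o ; ba_valP : ba_val \in is_ba }.

HB.instance Definition _ := [isSub for ba_val].
HB.instance Definition _ := [Choice of ba by <:].
HB.instance Definition _ := [SubChoice_isSubLmodule of ba by <:].

Lemma ba_of_probability_subproof (mu : probability T R) :
  (fun A : set T => if A \in measurable then fine (mu A) else 0) \in is_ba.
Proof.
rewrite inE; split=> [A B mA mB AB||A mA].
- have mAB := measurableU _ _ mA mB.
  by rewrite /= !mem_set//= !fineK ?fin_num_measure// measureU.
- exists 1 => A mA; rewrite mem_set// ger0_norm ?fine_ge0//.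
  by rewrite -lee_fin fineK ?fin_num_measure// probability_le1.
- by rewrite memNset.
Qed.

Definition ba_of_probability (mu : probability T R) : ba :=
  Ba (ba_of_probability_subproof mu).

Definition bounded_mfun := {f : T -> R | measurable_fun setT f /\ bounded_fun f}.

Definition sfun_uniform_nbhs (f : T -> R) : set_system {sfun T >-> R} :=
  filter_from [set e : R | 0 < e]
    (fun e => [set g : {sfun T >-> R} | forall x, `|f x - g x| <= e]).

(* The extension of the integral by uniform limits: the limit of the finite sums
   \sum_y y * mu (g = y) as the simple function g tends uniformly to f. *)
Definition ba_integral (mu : ba) (f : T -> R) : R :=
  lim ((fun g : {sfun T >-> R} => fine (sintegral (fun A => (mu A)%:E) g))
         @ sfun_uniform_nbhs f).

(* The coarsest topology on [ba] for which integration against every bounded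
   measurable function is continuous. *)
Definition weak_star : topologicalType :=
  sup_topology (fun f : bounded_mfun =>
    Topological.class
      (initial_topology (fun mu : ba => ba_integral mu (sval f)))).

(* Total variation norm; the supremum is taken in \bar R, where it needs no
   boundedness side condition. *)
Definition ba_norm (mu : ba) : \bar R :=
  ereal_sup [set x | exists n (F : 'I_n -> set T),
    [/\ forall i, measurable (F i), classical_sets.partition setT F setT
      & x = (\sum_i `|mu (F i)|)%:E]].

(* d_TV is half the norm of the difference. *)
Definition ba_dist (mu nu : ba) : \bar R := ((2^-1)%:E * ba_norm (mu - nu)%R)%E.

Definition ba_set_dist (S S' : set ba) : \bar R :=
  ereal_inf [set ba_dist mu nu | mu in S & nu in S'].

End ba.

Definition convex_hull (R : realType) (V : lmodType R) (A : set V) : set V :=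
  [set v | exists n (w : 'I_n -> R) (x : 'I_n -> V),
    [/\ forall i, 0 <= w i, \sum_i w i = 1, forall i, A (x i)
      & v = \sum_i w i *: x i]].

Section testing.
Context (d : measure_display) (T : measurableType d) (R : realType).
Implicit Types (P Q : set (probability T R)) (phi : T -> R).
Local Open Scope ereal_scope.

Definition co_weak_star P : set (ba T R) :=
  closure (convex_hull (@ba_of_probability d T R @` P) : set (weak_star T R)).

Definition tests : set (T -> R) :=
  [set phi : T -> R | measurable_fun setT phi /\ forall x, (0 <= phi x <= 1)%R].

Definition risk phi P Q : \bar R :=
  ereal_sup [set 'E_mu[phi] | mu in P]
  + ereal_sup [set 'E_nu[fun x => (1 - phi x)%R] | nu in Q].

Definition minimax_risk P Q : \bar R :=
  ereal_inf [set risk phi P Q | phi in tests].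

End testing.

(* Main.v *)
Require Import Defs.
From mathcomp Require Import all_boot all_order all_algebra.
From mathcomp Require Import all_classical all_reals all_analysis.
From mathcomp Require Import measurable_realfun ring lra.
Set Implicit Arguments.
Unset Strict Implicit.
Unset Printing Implicit Defensive.
Import Order.TTheory GRing.Theory Num.Theory.
Import numFieldNormedType.Exports HBSimple.
Local Open Scope classical_set_scope.
Local Open Scope ring_scope.

(** Let [c] be the minimax risk. Testing against a single pair of measures
    bounds [1 - c] by every distance between the two closures, because the
    conditions [E_mu phi <= sup_P E phi] and [E_nu phi >= inf_Q E phi] are convex
    and weak-* closed. Conversely it is enough to find [mu] and [nu] in the two
    closures with [nu B - mu B <= 1 - c] for all measurable [B]: this gives the
    missing inequality and shows that the infimum is attained.

    For finitely many sets [B] and up to [e], such a pair exists already in the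
    convex hulls, by Blackwell's approachability strategy: as no test has risk
    below [c], every nonnegative combination of the indicators of the sets [B] has
    a good response in [P x Q], and the average of the responses to the positive
    part of the accumulated excess works. These pairs generate a proper filter;
    along an ultrafilter refining it, the values on each measurable set converge,
    and the limits are finitely additive and are limits in the weak-* topology. *)

(** * Approachability *)

Section approachability.
Context (R : realType) (I : finType) (X : Type) (y : X -> I -> R) (B : R).
Context (yB : forall x i, `|y x i| <= B).
Context (response : forall l : I -> R, (forall i, 0 <= l i) ->
  exists x, \sum_i l i * y x i <= 0).

(** Responding to the positive part of the accumulated payoff keeps its squared norm at most linear
    in time, so every coordinate grows at most like a square root. *)
Lemma approachability (e : R) : 0 < e ->
  exists (n : nat) (x : 'I_n.+1 -> X),
    forall i, \sum_k y (x k) i <= e * n.+1%:R.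
Proof.
move=> e0.
have /choice[br brP] (w : I -> R) : exists x, \sum_i Num.max (w i) 0 * y x i <= 0.
  by apply: response => i; rewrite le_max lexx orbT.
pose w := fix w n : I -> R :=
  if n is n'.+1 then fun i => w n' i + y (br (w n')) i else fun=> 0.
have wS n i : w n.+1 i = w n i + y (br (w n)) i by [].
have wE n i : w n i = \sum_(k < n) y (br (w k)) i.
  by elim: n => [|n IH]; rewrite ?big_ord0// big_ord_recr /= -IH.
pose K : R := \sum_(i : I) B ^+ 2.
have K0 : 0 <= K by apply: sumr_ge0 => i _; exact: sqr_ge0.
(* Only the positive part of [w n] is met by the response, so its squared norm
   grows by at most [K] at each step. *)
have step n : \sum_i Num.max (w n i) 0 ^+ 2 <= n%:R * K.
  elim: n => [|n IH].
    by rewrite mul0r big1// => i _; rewrite maxxx expr0n.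
  rewrite -natr1 mulrDl mul1r.
  (* For nonpositive [w n i] the cross term vanishes and the new payoff alone is squared. Summed
     over [i], the cross terms are at most [0] by the choice of [br]. *)
  have sq i : Num.max (w n.+1 i) 0 ^+ 2 <=
      Num.max (w n i) 0 ^+ 2 + 2 * (Num.max (w n i) 0 * y (br (w n)) i) + B ^+ 2.
    rewrite wS; set a := w n i; set b := y _ i.
    have Hb := yB (br (w n)) i; rewrite -/b ler_norml in Hb.
    have b2 : b ^+ 2 <= B ^+ 2.
      by case/andP: Hb => ? ?; nra.
    have B2 := sqr_ge0 B.
    case: (leP a 0) => ha; case: (leP (a + b) 0) => hab; nra.
  rewrite (le_trans (ler_sum _ (fun i _ => sq i)))//.
  rewrite !big_split /= -/K -mulr_sumr lerD2r.
  rewrite (le_trans _ IH)// gerDl.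
  by rewrite mulr_ge0_le0// brP.
(* With [K / e ^+ 2 < n.+1], a coordinate above [e * n.+1] would have a square above [n.+1 * K],
   against [step]. *)
have /= hn := truncnS_gt (K / e ^+ 2); set n := Num.truncn _ in hn.
exists n, (fun k => br (w k)) => i; rewrite -wE leNgt; apply/negP => hlt.
have := step n.+1; rewrite leNgt => /negP; apply.
apply: (@lt_le_trans _ _ (Num.max (w n.+1 i) 0 ^+ 2)); last first.
  rewrite (bigD1 i)//= lerDl sumr_ge0// => j _; exact: sqr_ge0.
have n0 : (0 : R) < n.+1%:R by [].
have en0 : 0 < e * n.+1%:R by rewrite mulr_gt0.
rewrite max_l; last exact: ltW (lt_trans en0 hlt).
apply: (@lt_trans _ _ ((e * n.+1%:R) ^+ 2)).
  by move: hn; rewrite ltr_pdivrMr ?exprn_gt0//; nra.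
by rewrite ltr_sqr ?nnegrE; [exact: hlt|exact: ltW|exact: ltW (lt_trans en0 hlt)].
Qed.

End approachability.

(** * Integration against finitely additive set functions *)

Section finite_additivity.
Context d (T : measurableType d) (R : realType).
Implicit Types (mu nu : ba T R) (g h : {sfun T >-> R}).

Definition ba_bound mu (M : R) := forall A, measurable A -> `|mu A| <= M.

Lemma ba_boundP mu : exists M, ba_bound mu M.
Proof. by have := ba_valP mu; rewrite inE => -[]. Qed.

Lemma baU mu A B : measurable A -> measurable B -> A `&` B = set0 ->
  mu (A `|` B) = mu A + mu B.
Proof.
have := ba_valP mu; rewrite inE => -[mD _ _] mA mB AB.
by have [] := mD A B mA mB AB.
Qed.

Lemma ba0 mu : mu set0 = 0.
Proof.
have := baU mu measurable0 measurable0 (set0I _).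
by rewrite setU0 => /eqP; rewrite -subr_eq0 opprD addNKr oppr_eq0 => /eqP.
Qed.

Lemma baC mu A : measurable A -> mu (~` A) = mu setT - mu A.
Proof.
move=> mA; rewrite -(setUv A) baU ?setICr//; last exact: measurableC.
by rewrite addrAC subrr add0r.
Qed.

Definition simple_integral mu g : R :=
  fine (sintegral (fun A => (mu A)%:E) g).

(** * Finite measurable partitions as fibres of a map *)

Section fibres.
Context (U : choiceType) (p : T -> U) (s : seq U).
Context (us : uniq s).
Context (ps : forall t, p t \in s).
Context (mp : forall u, measurable (p @^-1` [set u])).

Lemma measurable_fibres (D : pred U) : measurable [set t | D (p t)].
Proof.
rewrite [X in measurable X](_ : _ =
    \big[setU/set0]_(u <- s | D u) (p @^-1` [set u])).
  exact: bigsetU_measurable.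
rewrite -bigcup_seq_cond; apply/seteqP; split => [t /= Dt|t [u /= /andP[_ Du] ->]//].
by exists (p t) => //=; rewrite ps.
Qed.

Lemma ba_fibres mu (D : pred U) :
  mu [set t | D (p t)] = \sum_(u <- s | D u) mu (p @^-1` [set u]).
Proof.
have {1}-> : [set t | D (p t)] =
    \big[setU/set0]_(u <- s | D u) (p @^-1` [set u]).
  rewrite -bigcup_seq_cond.
  apply/seteqP; split => [t /= Dt|t [u /= /andP[_ Du] ->]//].
  by exists (p t) => //=; rewrite ps.
elim: s us => [_|u r IH /= /andP[ur ru]]; first by rewrite !big_nil ba0.
rewrite !big_cons; case: ifPn => [Du|_]; last exact: IH.
rewrite baU ?IH//; first exact: bigsetU_measurable.
rewrite -bigcup_seq_cond; apply/seteqP; split => // t [/= ptu [v /= /andP[vr _] ptv]].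
by move: ur; rewrite -ptu ptv vr.
Qed.

(** A Hahn decomposition at the level of the partition: [D] is the union of the fibres of negative
    mass. As only [D] and its complement enter, a bound [M] on the values yields the factor [2 * M]
    of later estimates. *)
Lemma sum_norm_fibres mu : exists2 D, measurable D &
  \sum_(u <- s) `|mu (p @^-1` [set u])| = mu (~` D) - mu D.
Proof.
pose n u := mu (p @^-1` [set u]) < 0.
exists [set t | n (p t)]; first exact: measurable_fibres.
rewrite (_ : ~` _ = [set t | (predC n) (p t)]); last first.
  by apply/seteqP; split => t /= /negP.
rewrite !ba_fibres (bigID n)/= addrC -sumrN; congr +%R; apply: eq_bigr => u.
  by rewrite -leNgt => /ger0_norm.
exact: ltr0_norm.
Qed.

Lemma sum_norm_fibres_le mu M : ba_bound mu M ->
  \sum_(u <- s) `|mu (p @^-1` [set u])| <= 2 * M.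
Proof.
move=> muM; have [D mD ->] := sum_norm_fibres mu.
rewrite (le_trans (ler_norm _))// (le_trans (ler_normB _ _))//.
by rewrite mulr_natl mulr2n lerD// muM//; exact: measurableC.
Qed.

(** The fibres of [p] may be finer than the level sets of [g], so two simple functions can be
    integrated over a common partition. *)
Lemma simple_integral_fibres mu g (c : U -> R) : (forall t, g t = c (p t)) ->
  simple_integral mu g = \sum_(u <- s) c u * mu (p @^-1` [set u]).
Proof.
move=> gc; rewrite /simple_integral /sintegral.
rewrite -(@fsbig_widen _ _ _ _ [set` undup (map c s)])//=; last first.
  move=> x /= [_]; rewrite mem_undup => xs.
  rewrite preimage10 ?ba0 ?mule0//= => -[t _ gtx].
  by apply: xs; rewrite -gtx gc map_f.
rewrite -fsbig_seq ?undup_uniq//.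
under eq_bigr do rewrite -EFinM.
rewrite sumEFin/=.
have gE x : mu (g @^-1` [set x]) = \sum_(u <- s | c u == x) mu (p @^-1` [set u]).
  rewrite -(ba_fibres mu (fun u => c u == x)); congr (mu _).
  by apply/seteqP; split => t /=; rewrite gc => /eqP.
under eq_bigr do rewrite gE mulr_sumr big_mkcond/=.
rewrite exchange_big/= big_seq [RHS]big_seq; apply: eq_bigr => u us'.
rewrite -big_mkcond/= -big_filter.
rewrite (_ : [seq x <- _ | _] = [:: c u]) ?big_seq1//.
rewrite (eq_filter (_ : _ =1 pred1 (c u))); last by move=> x; rewrite /= eq_sym.
by rewrite filter_pred1_uniq ?undup_uniq// mem_undup map_f.
Qed.

End fibres.

Lemma sfun_seq g : exists2 s : seq R, uniq s & forall t, g t \in s.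
Proof.
have /finite_seqP[s gs] := fimfunP g.
exists (undup s) => [|t]; first exact: undup_uniq.
by have := imageT g t; rewrite gs /= mem_undup.
Qed.

Lemma simple_integralE mu g (s : seq R) : uniq s -> (forall t, g t \in s) ->
  simple_integral mu g = \sum_(x <- s) x * mu (g @^-1` [set x]).
Proof. by move=> us gs; apply: simple_integral_fibres. Qed.

(** On each nonempty fibre of the common refinement [p] the coefficients differ by at most [e], and
    the masses sum to at most [2 * M] in absolute value. *)
Lemma simple_integral_lipschitz mu M g h e : 0 <= e -> ba_bound mu M ->
  (forall t, `|g t - h t| <= e) ->
  `|simple_integral mu g - simple_integral mu h| <= e * (2 * M).
Proof.
move=> e0 muM ghe.
have [s us gs] := sfun_seq g; have [r ur hr] := sfun_seq h.
pose p t := (g t, h t); pose sr := [seq (x, y) | x <- s, y <- r].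
have usr : uniq sr by rewrite allpairs_uniq// => -[? ?] [? ?].
have psr t : p t \in sr by apply: allpairs_f.
have pE u : p @^-1` [set u] = g @^-1` [set u.1] `&` h @^-1` [set u.2].
  by apply/seteqP; split => t /=; rewrite /p; case: u => u v /= [-> ->].
have mp u : measurable (p @^-1` [set u]).
  by rewrite pE; apply: measurableI.
rewrite (simple_integral_fibres usr psr mp mu (c := fst))//.
rewrite (simple_integral_fibres usr psr mp mu (c := snd))//.
rewrite -sumrB (le_trans (ler_norm_sum _ _ _))//.
have /(le_trans _) -> // : e * \sum_(u <- sr) `|mu (p @^-1` [set u])| <= e * (2 * M).
  by rewrite ler_wpM2l ?(sum_norm_fibres_le usr).
rewrite mulr_sumr ler_sum// => -[u v] _ /=.
(* A pair in [sr] need not be attained; its fibre is then empty and has mass [0]. *)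
have [->|/set0P[t [/= gt ht]]] := eqVneq (p @^-1` [set (u, v)]) set0.
  by rewrite ba0 !mulr0 subrr normr0 mulr0.
rewrite -mulrBl normrM ler_wpM2r// -gt -ht; exact: ghe.
Qed.
End finite_additivity.

(** * Integrals of bounded measurable functions as uniform limits *)

Section integral.
Context d (T : measurableType d) (R : realType).
Implicit Types (mu nu : ba T R) (g h : {sfun T >-> R}).

(** Rounding down to multiples of [e] is monotone, hence measurable, and takes finitely many values
    on a bounded range. *)
Lemma sfun_approximation (f : T -> R) (e : R) : measurable_fun setT f ->
  bounded_fun f -> 0 < e ->
  exists g : {sfun T >-> R}, forall t, `|f t - g t| <= e.
Proof.
move=> mf [M [_ fM]] e0.
pose r (y : R) := e * (Num.floor (y / e))%:~R.
have r_nd : nondecreasing_fun r.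
  move=> y z yz; rewrite ler_wpM2l ?ler_int ?le_floor ?ler_wpM2r ?invr_ge0//;
    exact: ltW.
have mg : measurable_fun setT (r \o f).
  by apply: measurableT_comp mf; exact: nondecreasing_measurable.
have fing : finite_set (range (r \o f)).
  (* One successor compensates the truncation, the other the floor: the rounded quotients lie
     strictly between [-N] and [N]. *)
  pose N := (Num.truncn ((`|M| + 1) / e)).+2.
  apply: (@sub_finite_set _ _ ((fun k : nat => e * (k%:Z - N%:Z)%:~R) @` `I_(2 * N))).
    move=> _ [t _ <-].
    have ft : `|f t| <= `|M| + 1.
      by apply: fM => //; rewrite (le_lt_trans (ler_norm _))// ltrDl.
    set z := Num.floor (f t / e).
    have zN : `|z%:~R| < N%:R :> R.
      have := floor_le (f t / e); have := floorD1_gt (f t / e).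
      have := truncnS_gt ((`|M| + 1) / e).
      rewrite intrD1 -/z -/N ltr_pdivrMr// !ltr_pdivrMr// ler_pdivlMr// => h1 h2 h3.
      rewrite /N -!natr1 in h1 *; move: ft; rewrite ler_norml => /andP[ft1 ft2].
      rewrite ltr_norml; apply/andP; split; nra.
    have zN0 : 0 <= z + N%:Z.
      rewrite -(ler_int R) intrD; move: zN; rewrite ltr_norml => /andP[zN _].
      by rewrite -lerBlDr sub0r ltW.
    exists (absz (z + N%:Z)); last by rewrite /= gez0_abs// addrK.
    rewrite /= -ltz_nat gez0_abs// mul2n -addnn PoszD ltrD2r -(ltr_int R).
    exact: le_lt_trans (ler_norm _) zN.
  exact/finite_image/finite_II.
have gs : (r \o f) \in @sfun _ T R by apply/andP; rewrite !inE.
exists (sfun_Sub gs) => t /=; rewrite /r.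
have := floor_le (f t / e); have := floorD1_gt (f t / e).
rewrite intrD1 ltr_pdivrMr// ler_pdivlMr// => h1 h2.
by rewrite ger0_norm; [lra|nra].
Qed.

(** Uniform density of the simple functions makes the limit in [ba_integral] one along a proper
    filter. *)
Lemma sfun_uniform_nbhs_proper (f : T -> R) : measurable_fun setT f ->
  bounded_fun f -> ProperFilter (sfun_uniform_nbhs f).
Proof.
move=> mf bf; apply: filter_from_proper; last first.
  by move=> e /= e0; exact: sfun_approximation.
apply: filter_from_filter; first by exists 1 => /=.
move=> e1 e2 /= e10 e20; exists (Num.min e1 e2); rewrite /= ?lt_min ?e10//.
by move=> g /= fg; split => t; have := fg t; rewrite le_min => /andP[].
Qed.

(** The Lipschitz bound makes the simple integrals Cauchy as the simple functions tend to [f], and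
    it survives in the limit. Through this estimate, facts about simple functions are transferred to
    [ba_integral]. *)
Lemma ba_integral_approx mu M (f : T -> R) g e :
  measurable_fun setT f -> bounded_fun f -> ba_bound mu M ->
  0 <= e -> (forall t, `|f t - g t| <= e) ->
  `|ba_integral mu f - simple_integral mu g| <= e * (2 * M).
Proof.
move=> mf bf muM e0 fge.
have M0 : 0 <= M by rewrite (le_trans (normr_ge0 _) (muM _ measurable0)).
have PF := sfun_uniform_nbhs_proper mf bf.
pose S := simple_integral mu.
have lip e' g' h : 0 <= e' -> (forall t, `|g' t - h t| <= e') ->
  `|S g' - S h| <= e' * (2 * M) by move=> ? ?; exact: simple_integral_lipschitz.
have cS : cvg (S @ sfun_uniform_nbhs f).
  apply/cauchy_cvgP; apply: cauchy_exP => eps eps0.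
  (* Two simple functions within [e'] of [f] are within [2 * e'] of each other, so their integrals
     differ by at most [4 * M * e'], which is below [eps]. *)
  pose e' := eps / (4 * M + 2).
  have e'0 : 0 < e' by rewrite divr_gt0//; lra.
  have [g0 fg0] := sfun_approximation mf bf e'0.
  exists (S g0), e' => // h /= fh.
  rewrite -ball_normE /=.
  apply: (@le_lt_trans _ _ (2 * e' * (2 * M))).
    apply: lip => [|t]; first lra.
    rewrite mulr_natl mulr2n (le_trans (ler_distD (f t) _ _))// lerD//.
    by rewrite distrC.
  rewrite (_ : 2 * e' * _ = eps * (4 * M / (4 * M + 2))); last by rewrite /e'; ring.
  by rewrite gtr_pMr// ltr_pdivrMr; lra.
change (`|lim (S @ sfun_uniform_nbhs f) - S g| <= e * (2 * M)).
set l := lim _.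
apply/ler_addgt0Pr => eps eps0.
(* The limit costs [e'] and the enlarged Lipschitz bound an extra [e' * (2 * M)], in total [eps]. *)
pose e' := eps / (2 * M + 1).
have e'0 : 0 < e' by rewrite divr_gt0//; lra.
suff [h [fh lh]] : exists h, (forall t, `|f t - h t| <= e') /\ `|l - S h| <= e'.
  have := lip (e + e') h g; rewrite -/S => Shg.
  rewrite (le_trans (ler_distD (S h) _ _))//.
  apply: (@le_trans _ _ (e' + (e + e') * (2 * M))).
    rewrite lerD// Shg ?(addr_ge0 e0 (ltW e'0))// => t.
    rewrite (le_trans (ler_distD (f t) _ _))// addrC lerD//.
    by rewrite distrC.
  have -> : e' + (e + e') * (2 * M) = e * (2 * M) + e' * (2 * M + 1) by ring.
  by rewrite lerD2l divfK//; lra.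
have /cvgrPdist_le/(_ _ e'0) H : S @ sfun_uniform_nbhs f --> l by [].
have F' : sfun_uniform_nbhs f [set h | forall t, `|f t - h t| <= e'] by exists e'.
by have [h [? ?]] := filter_ex (filterI F' H); exists h.
Qed.

End integral.

Lemma ler_eps_mul (R : realType) (x y C : R) :
  (forall e, 0 < e -> x <= y + e * C) -> x <= y.
Proof.
move=> xy; apply/ler_addgt0Pr => eps eps0.
have C0 : 0 < `|C| + 1 by rewrite ltr_wpDl.
have e0 : 0 < eps / (`|C| + 1) by rewrite divr_gt0.
rewrite (le_trans (xy _ e0))// lerD2l -mulrA ger_pMr// mulrC ler_pdivrMr// mul1r.
by rewrite (le_trans (ler_norm _))// lerDl.
Qed.

(** * Linearity in the measure and agreement with the Lebesgue integral *)

Section linearity.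
Context d (T : measurableType d) (R : realType).
Implicit Types (mu nu : ba T R) (g h : {sfun T >-> R}).

Lemma ba_sumE n (w : 'I_n -> R) (m : 'I_n -> ba T R) (A : set T) :
  (\sum_i w i *: m i) A = \sum_i w i * m i A.
Proof.
rewrite -[LHS]/((fun nu : ba T R => (nu A : R)) (\sum_i w i *: m i)).
by apply: (big_morph (fun nu : ba T R => (nu A : R))).
Qed.

Lemma simple_integral_sum n (w : 'I_n -> R) (m : 'I_n -> ba T R) g :
  simple_integral (\sum_i w i *: m i) g = \sum_i w i * simple_integral (m i) g.
Proof.
have [s us gs] := sfun_seq g; rewrite (simple_integralE _ us gs).
under [RHS]eq_bigr do rewrite (simple_integralE _ us gs) mulr_sumr.
rewrite exchange_big/=; apply: eq_bigr => x _; rewrite ba_sumE mulr_sumr.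
by apply: eq_bigr => i _; rewrite mulrCA.
Qed.

Lemma ba_integral_sum n (w : 'I_n -> R) (m : 'I_n -> ba T R) (f : T -> R) :
  measurable_fun setT f -> bounded_fun f ->
  ba_integral (\sum_i w i *: m i) f = \sum_i w i * ba_integral (m i) f.
Proof.
move=> mf bf.
have [M muM] := ba_boundP (\sum_i w i *: m i).
have /choice[N mN] i := ba_boundP (m i).
apply/eqP; rewrite -subr_eq0 -normr_le0.
(* The approximation error of the combined measure plus those of the summands; on a simple function
   both sides agree. *)
apply: (@ler_eps_mul _ _ _ (2 * M + \sum_i `|w i| * (2 * N i))) => e e0.
have [g fg] := sfun_approximation mf bf e0.
rewrite add0r (le_trans (ler_distD (simple_integral (\sum_i w i *: m i) g) _ _))//.
rewrite mulrDr lerD//; first exact: (ba_integral_approx mf bf muM (ltW e0)).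
rewrite simple_integral_sum -sumrB (le_trans (ler_norm_sum _ _ _))// mulr_sumr.
apply: ler_sum => i _; rewrite -mulrBr normrM mulrCA ler_wpM2l// distrC.
exact: (ba_integral_approx mf bf (mN i) (ltW e0)).
Qed.

Lemma ba_integral_sfun mu g : ba_integral mu g = simple_integral mu g.
Proof.
have [M muM] := ba_boundP mu.
apply/eqP; rewrite -subr_eq0 -normr_le0.
have := @ba_integral_approx _ _ _ mu M g g 0 (measurable_funPT g) (simple_bounded g) muM.
by rewrite mul0r; apply=> // t; rewrite subrr normr0.
Qed.

Lemma ba_integral1 mu : ba_integral mu (cst 1) = mu setT.
Proof.
rewrite -[cst 1]/(cst_sfun 1 : T -> R) ba_integral_sfun.
rewrite (@simple_integralE _ _ _ _ _ [:: 1])// ?big_seq1 ?mul1r.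
  by congr (mu _); apply/seteqP; split.
by move=> t; rewrite inE.
Qed.

Lemma ba_of_probabilityE (m : probability T R) A : measurable A ->
  ((ba_of_probability m A)%:E = m A)%E.
Proof. by move=> mA; rewrite /= mem_set// fineK// fin_num_measure. Qed.

Lemma ba_bound_probability (m : probability T R) : ba_bound (ba_of_probability m) 1.
Proof.
move=> A mA; rewrite ger0_norm -lee_fin ba_of_probabilityE//.
exact: probability_le1.
Qed.

Lemma integrable_bounded (m : probability T R) (f : T -> R) :
  measurable_fun setT f -> bounded_fun f -> m.-integrable setT (EFin \o f).
Proof.
move=> mf bf; apply: measurable_bounded_integrable => //.
by rewrite ltey_eq fin_num_measure.
Qed.

Lemma Rintegral_sum_indic (m : probability T R) (I : Type) (s : seq I)
    (c : I -> R) (A : I -> set T) : (forall i, measurable (A i)) ->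
  \int[m]_x (\sum_(i <- s) c i * \1_(A i) x) =
  \sum_(i <- s) c i * ba_of_probability m (A i).
Proof.
move=> mA; rewrite /Rintegral; under eq_integral do rewrite -sumEFin.
have intA i : m.-integrable setT (fun x => (\1_(A i) x)%:E).
  exact: integrable_indic.
rewrite integral_sum//=; last first.
  by move=> i; under eq_fun do rewrite EFinM; exact: integrableZl.
rewrite (_ : (\sum_(i <- s) _)%E =
    (\sum_(i <- s) (c i * ba_of_probability m (A i))%:E)%E).
  by rewrite sumEFin.
apply: eq_bigr => i _; under eq_integral do rewrite EFinM.
by rewrite integralZl// integral_indic// setIT EFinM ba_of_probabilityE.
Qed.

Lemma Rintegral_sfun (m : probability T R) g :
  \int[m]_x g x = simple_integral (ba_of_probability m) g.
Proof.
have [s us gs] := sfun_seq g; rewrite (simple_integralE _ us gs).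
rewrite -(Rintegral_sum_indic m s id)//; apply: eq_Rintegral => x _.
rewrite (bigD1_seq (g x))//= indicE mem_set// mulr1 big1 ?addr0// => y yx.
by rewrite indicE memNset ?mulr0//= => gxy; rewrite gxy eqxx in yx.
Qed.

(** Both integrals are close to that of a common simple function, on which they agree. *)
Lemma Rintegral_ba_integral (m : probability T R) (f : T -> R) :
  measurable_fun setT f -> bounded_fun f ->
  \int[m]_x f x = ba_integral (ba_of_probability m) f.
Proof.
move=> mf bf; have intf := integrable_bounded m mf bf.
apply/eqP; rewrite -subr_eq0 -normr_le0.
(* [1] is the total mass on the Lebesgue side; [2 * 1] comes from [ba_integral_approx] with bound
   [1]. *)
apply: (@ler_eps_mul _ _ _ (1 + 2 * 1)) => e e0.
have [g fg] := sfun_approximation mf bf e0.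
have intg := integrable_bounded m (measurable_funPT g) (simple_bounded g).
rewrite add0r (le_trans (ler_distD (\int[m]_x g x) _ _))// mulrDr lerD//; last first.
  rewrite Rintegral_sfun distrC.
  exact: (ba_integral_approx mf bf (@ba_bound_probability m) (ltW e0)).
have intfg : m.-integrable setT (EFin \o (f \- g)).
  rewrite (_ : EFin \o _ = (EFin \o f) \- (EFin \o g))%E; first exact: integrableB.
  by apply/funext => x /=; rewrite EFinB.
rewrite -RintegralB// (le_trans (le_normr_Rintegral _ _))//.
rewrite mulr1 (_ : e = \int[m]_x (cst e x)); last first.
  by rewrite Rintegral_cst// [X in fine X](_ : _ = 1%E) ?mulr1//; exact: probability_setT.
apply: le_Rintegral => //.
  exact: integrable_norm.
exact: finite_measure_integrable_cst.
Qed.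

Lemma expectationE (m : probability T R) (f : T -> R) :
  measurable_fun setT f -> bounded_fun f ->
  ('E_m[f] = (ba_integral (ba_of_probability m) f)%:E)%E.
Proof.
move=> mf bf; rewrite -Rintegral_ba_integral// unlock fineK//.
exact/integrable_fin_num/integrable_bounded.
Qed.

End linearity.

(** * The weak-* topology *)

(** Compactness yields a cluster point, and an ultrafilter converges to its cluster points, since it
    contains every set or its complement. *)
Lemma ultra_fmap_cvg (X : Type) (V : topologicalType) (K : set V)
    (U : set_system X) (f : X -> V) : UltraFilter U -> compact K ->
  U (f @^-1` K) -> exists p : V, f @ U --> p.
Proof.
move=> UU cK UK; have [p [_ Up]] := cK (f @ U) _ UK.
exists p => A Ap; have [//|UA] := in_ultra_setVsetC (f @^-1` A) UU.
by have [z []] := Up (~` A) A UA Ap.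
Qed.

Lemma cvg_initial (S : choiceType) (V : topologicalType) (f : S -> V)
    (F : set_system S) (s : S) : Filter F ->
  f @ F --> f s -> F --> (s : initial_topology f).
Proof.
move=> FF fs A; rewrite nbhsE => -[B [[C oC <-] Cs] BA].
by apply: filterS BA _; apply: fs; exact: open_nbhs_nbhs.
Qed.

Section weak_star_topology.
Context d (T : measurableType d) (R : realType).
Implicit Types (mu nu : ba T R) (g h : {sfun T >-> R}) (f : T -> R).

Lemma ba_integral_continuous f : measurable_fun setT f -> bounded_fun f ->
  continuous ((fun mu : ba T R => ba_integral mu f) : weak_star T R -> R).
Proof.
move=> mf bf mu; pose i : bounded_mfun T R := exist _ f (conj mf bf).
have : nbhs (mu : weak_star T R) --> (mu : weak_star T R) by [].
move=> /cvg_sup => /(_ i) mui.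
apply: cvg_trans (@initial_continuous _ _ (fun nu : ba T R => ba_integral nu f) mu).
exact: cvg_app mui.
Qed.

Lemma cvg_weak_star (F : set_system (ba T R)) mu : Filter F ->
  (forall f, measurable_fun setT f -> bounded_fun f ->
    ba_integral nu f @[nu --> F] --> ba_integral mu f) ->
  F --> (mu : weak_star T R).
Proof.
by move=> FF H; apply/cvg_sup => -[f [mf bf]]; apply: cvg_initial; exact: H.
Qed.

(** Setwise convergence settles simple functions; the uniform bound [M] makes the approximation
    error independent of [x]. *)
Lemma ba_integral_cvg (X : Type) (U : set_system X) (m : X -> ba T R) mu M f :
  Filter U -> (\forall x \near U, ba_bound (m x) M) -> ba_bound mu M ->
  (forall A, measurable A -> m x A @[x --> U] --> (mu A : R)) ->
  measurable_fun setT f -> bounded_fun f ->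
  ba_integral (m x) f @[x --> U] --> ba_integral mu f.
Proof.
move=> FU mM muM mmu mf bf.
have M0 : 0 <= M by rewrite (le_trans (normr_ge0 _) (muM _ measurable0)).
apply/cvgrPdist_le => eps eps0.
(* The two approximations cost [e * (2 * M)] each, the convergence on [g] costs [e]. *)
pose e := eps / (4 * M + 1).
have e0 : 0 < e by rewrite divr_gt0//; lra.
have [g fg] := sfun_approximation mf bf e0.
have [s us gs] := sfun_seq g.
have : simple_integral (m x) g @[x --> U] --> simple_integral mu g.
  rewrite (simple_integralE _ us gs).
  under eq_fun do rewrite (simple_integralE _ us gs).
  apply: cvg_big => [|r _]; first exact: add_continuous.
  by apply: cvgMr; exact: mmu.
move=> /cvgrPdist_le/(_ _ e0); apply: filterS2 mM => x mxM mxg.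
rewrite (le_trans (ler_distD (simple_integral mu g) _ _))//.
have -> : eps = e * (2 * M) + (e + e * (2 * M)).
  by rewrite (_ : eps = e * (4 * M + 1)); [ring|rewrite divfK//; lra].
rewrite lerD//; first exact: (ba_integral_approx mf bf muM (ltW e0)).
rewrite (le_trans (ler_distD (simple_integral (m x) g) _ _))// lerD// distrC.
exact: (ba_integral_approx mf bf mxM (ltW e0)).
Qed.

(** A form of Banach-Alaoglu: the values on a measurable set eventually lie in the compact segment
    from [-M] to [M], and finite additivity and the bound pass to the setwise limits. *)
Lemma ba_ultra_limit (X : Type) (U : set_system X) (m : X -> ba T R) M :
  UltraFilter U -> (\forall x \near U, ba_bound (m x) M) ->
  exists mu, (forall A, measurable A -> m x A @[x --> U] --> (mu A : R)) /\
    m @ U --> (mu : weak_star T R).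
Proof.
move=> UU mM.
pose l (A : set T) : R^o := lim ((m x A : R) @[x --> U]).
have lP A : measurable A -> (m x A : R) @[x --> U] --> (l A : R).
  move=> mA; apply/cvg_ex.
  have [] := @ultra_fmap_cvg _ R `[-M, M]%classic U (fun x => m x A : R) UU.
  - exact: segment_compact.
  - by apply: filterS mM => x /(_ _ mA) /=; rewrite in_itv/= ler_norml.
  - by move=> p ?; exists p.
have lM A : measurable A -> `|l A : R| <= M.
  move=> mA; apply: (@closed_cvg _ _ U _ (fun x => m x A : R) (fun r => `|r| <= M)).
  - rewrite (_ : (fun r : R => _) = Num.norm @^-1` [set r : R | r <= M])//.
    by apply: preimage_closed; [move=> ? _; exact: norm_continuous|exact: closed_le].
  - by apply: filterS mM => x /(_ _ mA).
  - exact: lP.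
have lba : l \in @is_ba _ T R.
  rewrite inE; split=> [A B mA mB AB||A mA]; last 2 first.
  - by exists M.
  (* Off the sigma-algebra every [m x] vanishes, so the limit is normalized as well. *)
  - rewrite /l (_ : (fun x => _) = cst 0) ?lim_cst//.
    apply/funext => x; have := ba_valP (m x).
    by rewrite inE => -[_ _ ->].
  rewrite -EFinD; congr EFin.
  apply: (@cvg_unique R _ ((m x (A `|` B) : R) @[x --> U])) => //.
    by apply: lP; exact: measurableU.
  rewrite (_ : (fun x => m x (A `|` B)) = (fun x => (m x A : R) + m x B)); last first.
    by apply/funext => x; exact: baU.
  by apply: cvgD; exact: lP.
exists (Ba lba); split => //.
apply: cvg_weak_star => f mf bf.
exact: (@ba_integral_cvg _ U m (Ba lba) M f _ mM lM lP mf bf).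
Qed.

Lemma closure_cvg (X : Type) (V : topologicalType) (U : set_system X)
    (m : X -> V) (A : set V) v : ProperFilter U ->
  U (m @^-1` A) -> m @ U --> v -> closure A v.
Proof.
move=> PU UA mv B Bv.
by have [x [Ax Bx]] := @filter_ex _ _ PU _ (filterI UA (mv _ Bv : U (m @^-1` B))); exists (m x).
Qed.

Implicit Types P Q : set (probability T R).

Lemma ba_bound_hull P mu :
  convex_hull (@ba_of_probability d T R @` P) mu -> ba_bound mu 1.
Proof.
move=> [n [w [x [w0 w1 xP ->]]]] A mA; rewrite ba_sumE -w1.
rewrite (le_trans (ler_norm_sum _ _ _))//; apply: ler_sum => i _.
rewrite normrM ger0_norm// ler_piMr//.
by have [p _ <-] := xP i; exact: ba_bound_probability.
Qed.

(** Integration against [f] is weak-* continuous and linear, so the preimage of [D] is closed and,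
    by convexity of [D], contains the hull. *)
Lemma co_weak_star_closed P f (D : set R) : measurable_fun setT f ->
  bounded_fun f -> closed D ->
  (forall n (w x : 'I_n -> R), (forall i, 0 <= w i) -> \sum_i w i = 1 ->
    (forall i, D (x i)) -> D (\sum_i w i * x i)) ->
  (forall m, P m -> D (ba_integral (ba_of_probability m) f)) ->
  forall mu, co_weak_star P mu -> D (ba_integral mu f).
Proof.
move=> mf bf cD convD PD mu.
pose J : weak_star T R -> R := fun mu : ba T R => ba_integral mu f.
have cJ : closed (J @^-1` D).
  by apply: preimage_closed cD => ? _; exact: ba_integral_continuous.
suff /closureS/(_ mu) : (convex_hull (@ba_of_probability d T R @` P) :
    set (weak_star T R)) `<=` J @^-1` D.
  by rewrite -((closure_id _).1 cJ); apply.
move=> _ [n [w [x [w0 w1 xP ->]]]]; rewrite /J /preimage/= ba_integral_sum//.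
by apply: convD => // i; have [p Pp <-] := xP i; exact: PD.
Qed.

Lemma co_weak_star_le P f c : measurable_fun setT f -> bounded_fun f ->
  (forall m, P m -> ba_integral (ba_of_probability m) f <= c) ->
  forall mu, co_weak_star P mu -> ba_integral mu f <= c.
Proof.
move=> mf bf; apply: (@co_weak_star_closed P f [set r | r <= c]) => //.
move=> n w x w0 w1 xc /=; rewrite -[c]mul1r -w1 mulr_suml.
by apply: ler_sum => i _; rewrite ler_wpM2l//; exact: xc.
Qed.

Lemma co_weak_star_ge P f c : measurable_fun setT f -> bounded_fun f ->
  (forall m, P m -> c <= ba_integral (ba_of_probability m) f) ->
  forall mu, co_weak_star P mu -> c <= ba_integral mu f.
Proof.
move=> mf bf; apply: (@co_weak_star_closed P f [set r | c <= r]) => //.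
move=> n w x w0 w1 xc /=; rewrite -[c]mul1r -w1 mulr_suml.
by apply: ler_sum => i _; rewrite ler_wpM2l//; exact: xc.
Qed.

(** Provides the equality of total masses on which both comparisons with [ba_dist] rest. *)
Lemma co_weak_star_setT P mu : co_weak_star P mu -> mu setT = 1.
Proof.
have mc : measurable_fun setT (cst 1 : T -> R) by exact: measurable_cst.
have bc : bounded_fun (cst 1 : T -> R) by exact: bounded_cst.
have P1 m : ba_integral (ba_of_probability m) (cst 1) = 1 :> R.
  apply: EFin_inj; rewrite ba_integral1 ba_of_probabilityE//.
  exact: probability_setT.
move=> Pmu; apply/eqP; rewrite -(ba_integral1 mu) eq_le; apply/andP; split.
  by apply: (co_weak_star_le mc bc _ Pmu) => m _; rewrite P1.
by apply: (co_weak_star_ge mc bc _ Pmu) => m _; rewrite P1.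
Qed.

End weak_star_topology.

(** * Tests and total variation *)

Section tests_and_distance.
Context d (T : measurableType d) (R : realType).
Implicit Types (mu nu : ba T R) (P Q : set (probability T R)) (phi : T -> R).

Lemma test_bounded phi : tests phi -> bounded_fun phi.
Proof.
move=> [_ phi01]; exists 1; split => // M M1 t _.
by have /andP[p0 p1] := phi01 t; rewrite /= ger0_norm// (le_trans p1)// ltW.
Qed.

Lemma test_ba_integral phi m : tests phi ->
  0 <= ba_integral (@ba_of_probability d T R m) phi <= 1.
Proof.
move=> tphi; have bphi := test_bounded tphi; have [mphi phi01] := tphi.
rewrite -Rintegral_ba_integral//; apply/andP; split.
  by apply: Rintegral_ge0 => t _; case/andP: (phi01 t).
rewrite (_ : 1 = \int[m]_x (cst 1 x)); last first.
  by rewrite Rintegral_cst// [X in fine X](_ : _ = 1%E) ?mulr1//; exact: probability_setT.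
apply: le_Rintegral => //.
- exact: integrable_bounded.
- exact: finite_measure_integrable_cst.
- by move=> t _; case/andP: (phi01 t).
Qed.

Lemma test_expectation phi (m : probability T R) : tests phi ->
  ('E_m[phi] = (ba_integral (ba_of_probability m) phi)%:E)%E.
Proof. by move=> tphi; apply: expectationE (test_bounded tphi); case: tphi. Qed.

Lemma test_expectationC phi (m : probability T R) : tests phi ->
  ('E_m[fun x => (1 - phi x)%R] = (1 - ba_integral (ba_of_probability m) phi)%:E)%E.
Proof.
move=> tphi; have bphi := test_bounded tphi; have [mphi phi01] := tphi.
have intphi := integrable_bounded m mphi bphi.
rewrite EFinB -test_expectation// -(expectation_cst m 1).
rewrite -expectationB//.
- by rewrite inE; apply/Lfun1_integrable/finite_measure_integrable_cst.
- by apply/Lfun1_integrable.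
Qed.

(** Expectations of a test lie between [0] and [1], so over nonempty sets the supremum and the
    infimum are real; complementing the test turns the second supremum into [1 - b]. *)
Lemma test_values phi P Q : P !=set0 -> Q !=set0 -> tests phi ->
  exists a b : R, [/\ 0 <= a <= 1, 0 <= b <= 1,
    ereal_sup [set 'E_mu[phi] | mu in P]%E = a%:E,
    ereal_inf [set 'E_nu[phi] | nu in Q]%E = b%:E
    & risk phi P Q = (a + (1 - b))%:E].
Proof.
move=> [p0 Pp0] [q0 Qq0] tphi.
have E01 (m : probability T R) : (0 <= 'E_m[phi] <= 1)%E.
  by rewrite test_expectation// !lee_fin test_ba_integral.
rewrite /risk.
set sa := ereal_sup [set 'E_mu[phi] | mu in P]%E.
set sb := ereal_inf [set 'E_nu[phi] | nu in Q]%E.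
have sa0 : (0 <= sa)%E.
  by apply: le_ereal_sup_tmp; exists 'E_p0[phi]%E; [exists p0|case/andP: (E01 p0)].
have sa1 : (sa <= 1)%E.
  by apply: ge_ereal_sup => _ [m _ <-]; case/andP: (E01 m).
have sb1 : (sb <= 1)%E.
  by apply: ge_ereal_inf; exists 'E_q0[phi]%E; [exists q0|case/andP: (E01 q0)].
have sb0 : (0 <= sb)%E.
  by apply: le_ereal_inf_tmp => _ [m _ <-]; case/andP: (E01 m).
have /fineK aE : sa \is a fin_num.
  by rewrite ge0_fin_numE// (le_lt_trans sa1)// ltry.
have /fineK bE : sb \is a fin_num.
  by rewrite ge0_fin_numE// (le_lt_trans sb1)// ltry.
exists (fine sa), (fine sb).
rewrite -!lee_fin aE bE; split => //; try exact/andP.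
rewrite EFinD aE; congr (_ + _)%E; apply/eqP; rewrite eq_le; apply/andP; split.
  apply: ge_ereal_sup => _ [m Qm <-]; rewrite test_expectationC// lee_fin lerB//.
  by rewrite -lee_fin bE -test_expectation//; apply: ereal_inf_lbound; exists m.
apply/lee_addgt0Pr => e e0.
have [|_ [m Qm <-]] := @lb_ereal_inf_adherent _ [set 'E_nu[phi] | nu in Q]%E e e0.
  by rewrite -/sb -bE.
rewrite -/sb -bE test_expectation// -EFinD lte_fin => mb.
apply: (@le_trans _ _ (('E_m[fun x => (1 - phi x)%R] + e%:E))%E).
  by rewrite test_expectationC// -EFinD lee_fin; lra.
by rewrite leeD2r//; apply: ereal_sup_ubound; exists m.
Qed.

(* As [(mu - nu) setT = 0], [phi] may be replaced by [phi - 1/2], whose absolute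
   value is at most [1/2]: this yields the factor in the definition of [ba_dist]. *)
Lemma ba_integral_le_dist mu nu phi : mu setT = nu setT -> tests phi ->
  ((ba_integral nu phi - ba_integral mu phi)%:E <= ba_dist mu nu)%E.
Proof.
move=> mnT tphi; have bphi := test_bounded tphi; have [mphi phi01] := tphi.
have [M muM] := ba_boundP mu; have [N nuN] := ba_boundP nu.
(* [v] is the variation of [mu - nu] over the level sets of a simple [g] within [e] of [phi]. There
   [1/2 - g] is at most [1/2 + e] in absolute value, and the last two terms pay for replacing [phi]
   by [g]. *)
have key (e : R) : 0 < e -> exists v : R, [/\ 0 <= v, (v%:E <= ba_norm (mu - nu)%R)%E &
    ba_integral nu phi - ba_integral mu phi <=
    (2^-1 + e) * v + e * (2 * M) + e * (2 * N)].
  move=> e0; have [g fg] := sfun_approximation mphi bphi e0.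
  have /finite_seqP[s0 gs0] := fimfunP g.
  pose s := undup s0; have us : uniq s by exact: undup_uniq.
  have gs t : g t \in s by have := imageT g t; rewrite gs0 /= mem_undup.
  (* Every value in [s] has to be attained, as the blocks of a partition are nonempty. *)
  have sg x : x \in s -> exists t, g t = x.
    rewrite mem_undup => xs; have : range g x by rewrite gs0.
    by move=> [t _ <-]; exists t.
  have dE A : (mu - nu) A = mu A - nu A by [].
  pose v := \sum_(x <- s) `|(mu - nu) (g @^-1` [set x])|.
  exists v; split.
  - by apply: sumr_ge0.
  - apply: ereal_sup_ubound; exists (size s), (fun i => g @^-1` [set s`_i]).
    split.
    + by move=> i; exact: measurable_funPTI.
    + split.
      * apply/seteqP; split=> // t _.
        have ts : (index (g t) s < size s)%N by rewrite index_mem.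
        by exists (Ordinal ts) => //=; rewrite nth_index.
      * move=> i j _ _ [t /= [gi gj]]; apply/val_inj/eqP.
        by rewrite -(nth_uniq 0 (ltn_ord i) (ltn_ord j) us); apply/eqP; exact: etrans (esym gi) gj.
      * by move=> i _; have [t] := sg s`_i (mem_nth 0 (ltn_ord i)); exists t.
    + by rewrite /v (big_nth 0) big_mkord.
  - have mue := ba_integral_approx mphi bphi muM (ltW e0) fg.
    have nue := ba_integral_approx mphi bphi nuN (ltW e0) fg.
    suff : simple_integral nu g - simple_integral mu g <= (2^-1 + e) * v.
      move: mue nue; rewrite !ler_norml => /andP[? ?] /andP[? ?]; lra.
    have T0 : \sum_(x <- s) (mu - nu) (g @^-1` [set x]) = 0 :> R.
      rewrite -(ba_fibres us gs (fun x => measurable_funPTI g (measurable_set1 x)) _ xpredT).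
      rewrite (_ : [set t | _] = setT) ?dE ?mnT ?subrr//.
      by apply/seteqP; split.
    rewrite !(simple_integralE _ us gs) -sumrB.
    (* Recentring the coefficients at [1/2] costs nothing: the subtracted sum vanishes by [T0]. *)
    rewrite (eq_bigr (fun x => (2^-1 - x) * (mu - nu) (g @^-1` [set x]) -
      2^-1 * (mu - nu) (g @^-1` [set x]))); last first.
      by move=> x _; rewrite dE; ring.
    rewrite sumrB -mulr_sumr T0 mulr0 subr0 /v mulr_sumr.
    rewrite big_seq [leRHS]big_seq; apply: ler_sum => x /sg[t gt].
    rewrite (le_trans (ler_norm _))// normrM ler_wpM2r// -gt.
    have := phi01 t; have := fg t; rewrite !ler_norml; lra.
have Nm0 : (0 <= ba_norm (mu - nu)%R)%E.
  by have [v [v0 vN _]] := key _ ltr01; apply: le_trans vN; rewrite lee_fin.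
rewrite /ba_dist; move: Nm0 key.
case: (ba_norm (mu - nu)%R) => [r r0 key|_ _|//]; last first.
  by rewrite gt0_muley ?leey// lte_fin invr_gt0.
rewrite -EFinM lee_fin.
apply: (@ler_eps_mul _ _ _ (r + 2 * M + 2 * N)) => e e0.
have [v [v0]] := key e e0; rewrite lee_fin => vr /le_trans; apply.
by have := ler_wpM2l (ltW e0) vr; nra.
Qed.

(** With [D] the union of the blocks where [mu - nu] is negative, equal total masses turn the
    variation over a partition into [2 * (nu D - mu D)]. *)
Lemma ba_dist_le mu nu (c : R) : mu setT = nu setT ->
  (forall B, measurable B -> nu B - mu B <= c) -> (ba_dist mu nu <= c%:E)%E.
Proof.
move=> mnT munu.
suff : (ba_norm (mu - nu)%R <= (2 * c)%:E)%E.
  move=> H; rewrite /ba_dist (_ : c%:E = (2^-1)%:E * (2 * c)%:E)%E; last first.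
    by rewrite -EFinM mulrA mulVf ?mul1r.
  by rewrite lee_wpmul2l// lee_fin invr_ge0.
apply: ge_ereal_sup => _ [n [F [mF [cF tF _] ->]]]; rewrite lee_fin.
have /choice[p pP] t : exists i, F i t.
  by have : [set: T] t by []; rewrite -cF => -[i _ ?]; exists i.
have pF i : p @^-1` [set i] = F i.
  apply/seteqP; split => [t /= <- //|t Fit /=].
  by apply: (tF _ _ I I); exists t; split => //; exact: pP.
have mp i : measurable (p @^-1` [set i]) by rewrite pF.
have ups := index_enum_uniq 'I_n; have ps t := mem_index_enum (p t).
under eq_bigr do rewrite -pF.
have [D mD ->] := sum_norm_fibres ups ps mp (mu - nu).
have dE A : (mu - nu) A = mu A - nu A by [].
by rewrite baC// !dE mnT subrr; have := munu _ mD; lra.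
Qed.

End tests_and_distance.

(** * A pair of limit measures attaining the distance *)

Section minimax.
Context d (T : measurableType d) (R : realType).
Context (P Q : set (probability T R)) (P0 : P !=set0) (Q0 : Q !=set0).
Context (c : R).
Context (risk_ge : forall phi : T -> R, tests phi -> (c%:E <= risk phi P Q)%E).

(** Dividing the weights by their sum turns the combination of indicators into a test. Its risk is
    at least [c], so [b - a <= 1 - c], and near-optimal [p] and [q] lose less than [e / 2] each. *)
Lemma best_response (I : finType) (B : I -> set T) (l : I -> R) (e : R) :
  (forall i, measurable (B i)) -> (forall i, 0 <= l i) -> 0 < e ->
  exists m : probability T R * probability T R, [/\ P m.1, Q m.2 &
    \sum_i l i * (ba_of_probability m.2 (B i) - ba_of_probability m.1 (B i)
      - (1 - c + e)) <= 0].
Proof.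
move=> mB l0 e0.
have L0 : 0 <= \sum_i l i by exact: sumr_ge0.
have [L00|Ln0] := eqVneq (\sum_i l i) 0.
  have [p Pp] := P0; have [q Qq] := Q0; exists (p, q); split => //=.
  rewrite big1// => i _; suff -> : l i = 0 by rewrite mul0r.
  by apply/eqP; move/eqP: L00; rewrite psumr_eq0// => /allP; apply; rewrite mem_index_enum.
have {L0 Ln0} Lp : 0 < \sum_i l i by rewrite lt_neqAle eq_sym Ln0.
set L := \sum_i l i in Lp *.
pose phi t : R := \sum_i l i / L * \1_(B i) t.
have tphi : tests phi.
  split; first by apply: measurable_sum => i; apply: measurable_funM => //;
    exact: measurable_indic.
  move=> t; apply/andP; split.
    by apply: sumr_ge0 => i _; rewrite !mulr_ge0// invr_ge0 ltW.
  rewrite (_ : 1 = \sum_i l i / L); last by rewrite -mulr_suml divff// gt_eqF.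
  apply: ler_sum => i _; apply: ler_piMr; first by rewrite divr_ge0// ltW.
  by rewrite indicE; case: (_ \in _).
have phiE m : ba_integral (@ba_of_probability d T R m) phi =
    (\sum_i l i * ba_of_probability m (B i)) / L.
  rewrite -Rintegral_ba_integral; [|by case: tphi|exact: test_bounded].
  rewrite Rintegral_sum_indic// mulr_suml; apply: eq_bigr => i _.
  by rewrite mulrAC.
have [a [b [_ _ aE bE rE]]] := test_values P0 Q0 tphi.
have cab : c <= a + (1 - b) by rewrite -lee_fin -rE risk_ge.
have e20 : 0 < e / 2 by rewrite divr_gt0.
have [|_ [p Pp <-]] :=
  @ub_ereal_sup_adherent _ [set 'E_mu[phi] | mu in P]%E _ e20.
  by rewrite aE.
rewrite aE test_expectation// -EFinB lte_fin => pa.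
have [|_ [q Qq <-]] :=
  @lb_ereal_inf_adherent _ [set 'E_nu[phi] | nu in Q]%E _ e20.
  by rewrite bE.
rewrite bE test_expectation// -EFinD lte_fin => qb.
exists (p, q); split => //=.
under eq_bigr do rewrite !mulrBr.
rewrite !sumrB -mulr_suml -/L.
have : (ba_integral (ba_of_probability q) phi -
        ba_integral (ba_of_probability p) phi) <= 1 - c + e by lra.
by rewrite !phiE -mulrBl ler_pdivrMr//; lra.
Qed.

(** The payoff of a pair on [B i] is its excess over [1 - c + e / 2]; the other [e / 2] is the
    approachability error. Uniform averages of the responses are the two hull elements. *)
Lemma hull_pair (s : seq (set T)) (e : R) :
  (forall B, B \in s -> measurable B) -> 0 < e ->
  exists mu nu : ba T R,
    [/\ convex_hull (@ba_of_probability d T R @` P) mu,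
        convex_hull (@ba_of_probability d T R @` Q) nu
      & forall B, B \in s -> nu B - mu B <= 1 - c + e].
Proof.
move=> ms e0; pose B (i : 'I_(size s)) := nth set0 s i.
have mB i : measurable (B i) by apply: ms; exact: mem_nth.
have e20 : 0 < e / 2 by rewrite divr_gt0.
pose X := {m : probability T R * probability T R | P m.1 /\ Q m.2}.
pose y (m : X) i := ba_of_probability (sval m).2 (B i) -
  ba_of_probability (sval m).1 (B i) - (1 - c + e / 2).
have [|l l0|n [x xe]] := @approachability R _ X y (2 + `|1 - c + e / 2|) _ _ _ e20.
- move=> m i; rewrite /y (le_trans (ler_normB _ _))// lerD2r.
  rewrite (le_trans (ler_normB _ _))// (_ : 2 = 1 + 1 :> R)//.
  by rewrite lerD// ba_bound_probability.
- have [m [Pm Qm ml]] := best_response mB l0 e20.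
  by exists (exist _ m (conj Pm Qm)).
pose w (_ : 'I_n.+1) : R := n.+1%:R^-1.
have w0 i : 0 <= w i by rewrite invr_ge0.
have w1 : \sum_i w i = 1.
  by rewrite /w sumr_const card_ord -[LHS]mulr_natl mulfV.
pose mu := \sum_k w k *: ba_of_probability (sval (x k)).1.
pose nu := \sum_k w k *: ba_of_probability (sval (x k)).2.
exists mu, nu; split.
- exists n.+1, w, (fun k => ba_of_probability (sval (x k)).1); split => // k.
  by exists (sval (x k)).1 => //; have [] := svalP (x k).
- exists n.+1, w, (fun k => ba_of_probability (sval (x k)).2); split => // k.
  by exists (sval (x k)).2 => //; have [] := svalP (x k).
move=> A As; have iA : (index A s < size s)%N by rewrite index_mem.
have -> : A = B (Ordinal iA) by rewrite /B /= nth_index.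
move: (Ordinal iA) => i {A As iA}.
rewrite /nu /mu !ba_sumE -!mulr_sumr -mulrBr -sumrB mulrC ler_pdivrMr//.
have := xe i; rewrite [X in X <= _]sumrB sumr_const card_ord -mulr_natr.
set S := \sum_k _; lra.
Qed.

Lemma minimax_pair : exists mu nu : ba T R,
  [/\ co_weak_star P mu, co_weak_star Q nu & (ba_dist mu nu <= (1 - c)%:E)%E].
Proof.
(* Indices are finite lists of sets with a tolerance; concatenating the lists and taking the smaller
   tolerance refines two constraints at once. *)
pose D := [set z : seq (set T) * R | (forall B, B \in z.1 -> measurable B) /\ 0 < z.2].
pose G (z : seq (set T) * R) := [set m : ba T R * ba T R |
  [/\ convex_hull (@ba_of_probability d T R @` P) m.1,
        convex_hull (@ba_of_probability d T R @` Q) m.2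
      & forall B, B \in z.1 -> m.2 B - m.1 B <= 1 - c + z.2]].
have FG : Filter (filter_from D G).
  apply: filter_from_filter; first by exists ([::], 1); split.
  move=> [s1 e1] [s2 e2] [/= ms1 e10] [/= ms2 e20].
  exists (s1 ++ s2, Num.min e1 e2).
    by split => /= [B|]; rewrite ?lt_min ?e10// mem_cat => /orP[/ms1|/ms2].
  move=> [mu nu] [/= Pmu Qnu H].
  by split; split => //= B Bs; rewrite (le_trans (H B _))//;
    rewrite ?mem_cat ?Bs ?orbT// lerD2l ge_min lexx ?orbT.
have {FG} FG : ProperFilter (filter_from D G).
  apply: filter_from_proper => -[s e] [/= ms e0].
  by have [mu [nu H]] := hull_pair ms e0; exists (mu, nu).
(* One ultrafilter on pairs serves both components, so the inequalities coupling them survive in the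
   limits. *)
have [U [UU GU]] := ultraFilterLemma FG.
have UG s e : (forall B, B \in s -> measurable B) -> 0 < e -> U (G (s, e)).
  by move=> ms e0; apply: GU; exists (s, e).
have U0 : U (G ([::], 1)) by apply: UG.
have [mu [mmu cmu]] : exists mu : ba T R,
    (forall A, measurable A -> (fun m : ba T R * ba T R => m.1 A : R) @ U --> (mu A : R)) /\
    fst @ U --> (mu : weak_star T R).
  apply: (ba_ultra_limit (M := 1)).
  by apply: filterS U0 => m [/= Pm _ _]; exact: ba_bound_hull Pm.
have [nu [mnu cnu]] : exists nu : ba T R,
    (forall A, measurable A -> (fun m : ba T R * ba T R => m.2 A : R) @ U --> (nu A : R)) /\
    snd @ U --> (nu : weak_star T R).
  apply: (ba_ultra_limit (M := 1)).
  by apply: filterS U0 => m [/= _ Qm _]; exact: ba_bound_hull Qm.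
have Pmu : co_weak_star P mu.
  by apply: (@closure_cvg _ (weak_star T R) U fst _ mu _ _ cmu); apply: filterS U0 => m [].
have Qnu : co_weak_star Q nu.
  by apply: (@closure_cvg _ (weak_star T R) U snd _ nu _ _ cnu); apply: filterS U0 => m [].
exists mu, nu; split => //; apply: ba_dist_le.
  by rewrite (co_weak_star_setT Pmu) (co_weak_star_setT Qnu).
move=> B mB; apply/ler_addgt0Pr => e e0.
apply: (@closed_cvg _ _ U _ (fun m : ba T R * ba T R => m.2 B - m.1 B : R)
  (fun r : R => r <= 1 - c + e)).
- exact: closed_le.
- apply: filterS (UG [:: B] e _ e0) => [m [_ _]|A]; last by rewrite inE => /eqP ->.
  by apply; rewrite inE.
- by apply: cvgB; [exact: mnu|exact: mmu].
Qed.

End minimax.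

Unset Implicit Arguments.
Local Open Scope ereal_scope.

Theorem theorem1p5 (d : measure_display) (T : measurableType d) (R : realType)
    (P Q : set (probability T R)) (P0 : P !=set0) (Q0 : Q !=set0) :
  [/\ forall eps : R, (0 <= eps)%R ->
        ((exists2 phi : T -> R, tests phi &
            ereal_sup [set 'E_mu[phi] | mu in P] + eps%:E
              < ereal_inf [set 'E_nu[phi] | nu in Q])
         <-> eps%:E < ba_set_dist (co_weak_star P) (co_weak_star Q)),
      minimax_risk P Q = 1 - ba_set_dist (co_weak_star P) (co_weak_star Q)
    & exists mu nu : ba T R,
        [/\ co_weak_star P mu, co_weak_star Q nu
          & ba_dist mu nu = ba_set_dist (co_weak_star P) (co_weak_star Q)]].
Proof.
(* The minimax risk is a real number: risks of tests are nonnegative, and the constant test [0] has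
   finite risk. *)
have r0 : 0 <= minimax_risk P Q.
  apply: le_ereal_inf_tmp => _ [phi tphi <-].
  have [a [b [a01 b01 _ _ ->]]] := test_values P0 Q0 tphi.
  by rewrite lee_fin; lra.
have roo : minimax_risk P Q < +oo.
  have t0 : tests (cst 0%R : T -> R) by split => // t; rewrite lexx ler01.
  apply: (@le_lt_trans _ _ (risk (cst 0%R) P Q)).
    by apply: ereal_inf_lbound; exists (cst 0%R).
  by have [a [b [_ _ _ _ ->]]] := test_values P0 Q0 t0; rewrite ltry.
have [c cE] : exists c, minimax_risk P Q = c%:E.
  by exists (fine (minimax_risk P Q)); rewrite fineK// ge0_fin_numE.
have risk_ge phi : tests phi -> c%:E <= risk phi P Q.
  by move=> tphi; rewrite -cE; apply: ereal_inf_lbound; exists phi.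
have dist_ge mu nu : co_weak_star P mu -> co_weak_star Q nu ->
    (1 - c)%:E <= ba_dist mu nu.
  move=> Pmu Qnu.
  have mnT : mu setT = nu setT.
    by rewrite (co_weak_star_setT Pmu) (co_weak_star_setT Qnu).
  have H phi : tests phi -> 1 - ba_dist mu nu <= risk phi P Q.
    move=> tphi; have [a [b [_ _ aE bE ->]]] := test_values P0 Q0 tphi.
    have bphi := test_bounded tphi; have [mphi _] := tphi.
    have mua : (ba_integral mu phi <= a)%R.
      apply: (co_weak_star_le mphi bphi _ Pmu) => m Pm.
      rewrite -lee_fin -test_expectation// -aE.
      by apply: ereal_sup_ubound; exists m.
    have nub : (b <= ba_integral nu phi)%R.
      apply: (co_weak_star_ge mphi bphi _ Qnu) => m Qm.
      rewrite -lee_fin -test_expectation// -bE.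
      by apply: ereal_inf_lbound; exists m.
    (* By [mua] and [nub], [b - a] is at most the difference of the integrals of [phi], hence at
       most the distance. *)
    apply: (@le_trans _ _ (1 - (b - a)%:E)); last first.
      by rewrite -EFinB lee_fin; lra.
    rewrite leeB// (le_trans _ (ba_integral_le_dist mnT tphi))// lee_fin; lra.
  have : 1 - ba_dist mu nu <= c%:E.
    by rewrite -cE; apply: le_ereal_inf_tmp => _ [phi tphi <-]; exact: H.
  case: (ba_dist mu nu) => [x| |] //=; last by move=> _; rewrite leey.
  by rewrite -EFinB !lee_fin; lra.
have [mu [nu [Pmu Qnu mnc]]] := minimax_pair P0 Q0 risk_ge.
have distE : ba_set_dist (co_weak_star P) (co_weak_star Q) = (1 - c)%:E.
  apply/eqP; rewrite eq_le; apply/andP; split.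
    by apply: le_trans mnc; apply: ereal_inf_lbound; exists mu => //; exists nu.
  by apply: le_ereal_inf_tmp => _ [m Pm [n Qn <-]]; exact: dist_ge.
rewrite distE; split; last 2 first.
- by rewrite cE -EFinB; congr EFin; lra.
- exists mu, nu; split => //; apply/eqP; rewrite eq_le mnc /=; exact: dist_ge.
move=> eps _; split => [[phi tphi]|].
  (* Separation by more than [eps] means risk [a + (1 - b)] below [1 - eps], which forces [c] below
     it too. *)
  have [a [b [_ _ -> -> rE]]] := test_values P0 Q0 tphi.
  have := risk_ge phi tphi; rewrite rE -EFinD !lte_fin lee_fin; lra.
rewrite lte_fin => epsc.
(* Strictness leaves room for a test of risk below [1 - eps], without appeal to an optimal test. *)
have : minimax_risk P Q < (1 - eps)%:E by rewrite cE lte_fin; lra.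
move=> /ereal_inf_lt[_ [phi tphi <-]].
have [a [b [_ _ aE bE ->]]] := test_values P0 Q0 tphi.
rewrite lte_fin => abe; exists phi => //.
by rewrite aE bE -EFinD lte_fin; lra.
Qed.
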